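(* Let $p$ be an odd prime and let $d$ be the multiplicative order of $2$ modulo $p$. Then the group $\mathcal{B}(F_2D_{2p})$ generated by the bicyclic units of $F_2D_{2p}$ satisfies $$\mathcal{B}(F_2D_{2p}) \cong \begin{cases} \underbrace{SL_2(F_{2^{d/2}}) \times \cdots \times SL_2(F_{2^{d/2}})}_{\frac{\phi(p)}{d}\ \text{copies}}, & \text{if } d \text{ is even},\\[2ex] \underbrace{SL_2(F_{2^{d}}) \times \cdots \times SL_2(F_{2^{d}})}_{\frac{\phi(p)}{2d}\ \text{copies}}, & \text{if } d \text{ is odd},\end{cases}$$ where $SL_2(F)$ is the special linear group of degree $2$ over $F$.
   Context: $F_q$ denotes the finite field with $q$ elements, and $\phi$ is Euler's totient function, so $\phi(p)=p-1$. $D_{2p} = \langle a, b \mid a^p = 1,\ b^2 = 1,\ b^{-1}ab = a^{-1}\rangle$ is the dihedral group of order $2p$, and $F_2D_{2p}$ is its group algebra over $F_2$. For a group $G$, a field $F$, an element $g\in G$ of finite order $n$ and $h\in G$, put $\widehat{g} = 1+g+\cdots+g^{n-1}$; the element $u_{g,h} = 1+(g-1)h\widehat{g}$ of $FG$ is a unit (with inverse $1-(g-1)h\widehat{g}$), called a bicyclic unit. $\mathcal{B}(FG)$ is the subgroup of the unit group of $FG$ generated by all bicyclic units. *)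

(* Defs.v *)
From HB Require Import structures.
From mathcomp Require Import all_boot all_order all_fingroup all_algebra.
From mathcomp Require Import all_solvable all_field.

Set Implicit Arguments.
Unset Strict Implicit.
Unset Printing Implicit Defensive.

Import GroupScope GRing.Theory FinRing.Theory.
Local Open Scope ring_scope.

(* An element is the function of its coefficients.  The alias hides the       *)
(* pointwise product of {ffun gT -> F}: the product below is convolution.     *)
Definition group_algebra (F : Type) (gT : finGroupType) : Type :=
  {ffun gT -> F}.
Arguments group_algebra F%_type gT%_type.

Section GroupAlgebra.

Variables (F : comNzRingType) (gT : finGroupType).
Implicit Types (f g h : group_algebra F gT) (x y z : gT).

HB.instance Definition _ := GRing.Lmodule.copy
  (group_algebra F gT) {ffun gT -> F^o}.

Definition galg_elt x : group_algebra F gT := [ffun y => (y == x)%:R].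

Definition galg_mul f g : group_algebra F gT :=
  [ffun x => \sum_y f y * g (y^-1 * x)%g].

Fact galg_mulA : associative galg_mul.
Proof.
move=> f g h; apply/ffunP=> x; rewrite !ffunE.
under eq_bigr do rewrite ffunE mulr_sumr.
under [RHS]eq_bigr do rewrite ffunE mulr_suml.
rewrite [RHS]exchange_big /=; apply: eq_bigr => y _.
rewrite [RHS](reindex_inj (mulgI y)) /=; apply: eq_bigr => z _.
by rewrite mulKg invMg mulgA mulrA.
Qed.

Fact galg_mul1 : left_id (galg_elt 1%g) galg_mul.
Proof.
move=> f; apply/ffunP=> x; rewrite ffunE (bigD1 1%g) //= ffunE eqxx mul1r.
rewrite invg1 mul1g big1 ?addr0 // => y ny1.
by rewrite ffunE (negPf ny1) mul0r.
Qed.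

Fact galg_mulr1 : right_id (galg_elt 1%g) galg_mul.
Proof.
move=> f; apply/ffunP=> x; rewrite ffunE (bigD1 x) //= ffunE mulVg eqxx mulr1.
rewrite big1 ?addr0 // => y nyx.
by rewrite ffunE -eq_mulVg1 (negPf nyx) mulr0.
Qed.

Fact galg_mulDl : left_distributive galg_mul +%R.
Proof.
move=> f g h; apply/ffunP=> x; rewrite !ffunE -big_split /=.
by apply: eq_bigr => y _; rewrite ffunE mulrDl.
Qed.

Fact galg_mulDr : right_distributive galg_mul +%R.
Proof.
move=> f g h; apply/ffunP=> x; rewrite !ffunE -big_split /=.
by apply: eq_bigr => y _; rewrite ffunE mulrDr.
Qed.

Fact galg_1_neq0 : galg_elt 1%g != 0.
Proof.
apply/eqP=> /ffunP/(_ 1%g)/eqP; rewrite !ffunE eqxx.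
exact/negP/oner_neq0.
Qed.

HB.instance Definition _ := GRing.Zmodule_isNzRing.Build (group_algebra F gT)
  galg_mulA galg_mul1 galg_mulr1 galg_mulDl galg_mulDr galg_1_neq0.

Fact galg_scaleAl (a : F) f g : a *: (f * g) = (a *: f) * g.
Proof.
apply/ffunP=> x; rewrite !ffunE scaler_sumr.
by apply: eq_bigr => y _; rewrite ffunE scalerAl.
Qed.

HB.instance Definition _ :=
  GRing.Lmodule_isLalgebra.Build F (group_algebra F gT) galg_scaleAl.

Fact galg_scaleAr (a : F) f g : a *: (f * g) = f * (a *: g).
Proof.
apply/ffunP=> x; rewrite !ffunE scaler_sumr.
by apply: eq_bigr => y _; rewrite ffunE scalerAr.
Qed.

HB.instance Definition _ :=
  GRing.Lalgebra_isAlgebra.Build F (group_algebra F gT) galg_scaleAr.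

Lemma galg_elt1 : galg_elt 1%g = 1. Proof. by []. Qed.

Lemma galg_eltM x y : galg_elt (x * y)%g = galg_elt x * galg_elt y.
Proof.
apply/ffunP=> z; rewrite !ffunE (bigD1 x) //= !ffunE eqxx mul1r big1 ?addr0.
  by rewrite -(inj_eq (mulgI x) (x^-1 * z)%g) mulKVg.
by move=> t ntx; rewrite ffunE (negPf ntx) mul0r.
Qed.

Definition galg_hat x : group_algebra F gT :=
  \sum_(i < #[x]%g) galg_elt (x ^+ i)%g.

(* y is any element of the group, so bicyclic x y may be 1. *)
Definition bicyclic x y : group_algebra F gT :=
  1 + (galg_elt x - 1) * galg_elt y * galg_hat x.

Definition bicyclic_inv x y : group_algebra F gT :=
  1 - (galg_elt x - 1) * galg_elt y * galg_hat x.

Lemma galg_hat_mulr x : galg_hat x * (galg_elt x - 1) = 0.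
Proof.
rewrite mulrBr mulr1 mulr_suml; under eq_bigr do rewrite -galg_eltM -expgSr.
rewrite /galg_hat; have := order_gt0 x; have := expg_order x.
case: #[x]%g => // n xn _.
by rewrite big_ord_recr [X in _ - X]big_ord_recl /= xn addrC subrr.
Qed.

Lemma bicyclic_sq0 x y (n := (galg_elt x - 1) * galg_elt y * galg_hat x) :
  n * n = 0.
Proof.
rewrite /n -!mulrA [galg_hat x * _]mulrA galg_hat_mulr.
by rewrite mul0r !mulr0.
Qed.

Lemma bicyclicK x y : bicyclic x y * bicyclic_inv x y = 1.
Proof.
rewrite /bicyclic /bicyclic_inv; have := bicyclic_sq0 x y.
move: (_ * _ * _) => n n2; rewrite mulrBr mulr1 mulrDl n2.
by rewrite mul1r addr0 addrK.
Qed.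

Lemma bicyclicVK x y : bicyclic_inv x y * bicyclic x y = 1.
Proof.
rewrite /bicyclic /bicyclic_inv; have := bicyclic_sq0 x y.
move: (_ * _ * _) => n n2; rewrite mulrDr mulr1 mulrBl n2.
by rewrite mul1r subr0 subrK.
Qed.

End GroupAlgebra.

Arguments bicyclic F {gT} x y.
Arguments bicyclic_inv F {gT} x y.

HB.instance Definition _ (F : finComNzRingType) (gT : finGroupType) :=
  Finite.copy (group_algebra F gT) {ffun gT -> F^o}.
HB.instance Definition _ (F : finComNzRingType) (gT : finGroupType) :=
  FinRing.isNzRing.Build (group_algebra F gT).

Section BicyclicUnits.

Variables (F : finFieldType) (gT : finGroupType).

Fact bicyclic_is_unit (x y : gT) : bicyclic F x y \is a GRing.unit.
Proof.
by apply/unitrP; exists (bicyclic_inv F x y); rewrite bicyclicK bicyclicVK.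
Qed.

Definition bicyclic_unit (x y : gT) : {unit group_algebra F gT} :=
  FinRing.unit (group_algebra F gT) (bicyclic_is_unit x y).

Definition bicyclic_group : {group {unit group_algebra F gT}} :=
  <<[set bicyclic_unit x y | x : gT, y : gT]>>%G.

End BicyclicUnits.

Arguments bicyclic_group F%_type gT%_type.

Section SpecialLinear.

Variables (n : nat) (F : finFieldType).

Definition SLset : {set {'GL_n[F]}} := [set u | \det (GLval u) == 1].

Fact SLset_group_set : group_set SLset.
Proof.
apply/group_setP; split=> [|u v]; first by rewrite inE GL_1E det1.
by rewrite !inE GL_ME det_mulmx => /eqP-> /eqP->; rewrite mulr1.
Qed.

Canonical SLgroup : {group {'GL_n[F]}} := Group SLset_group_set.

End SpecialLinear.

Notation "''SL_' n [ F ]" := (SLgroup n F)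
  (at level 8, n at level 2, format "''SL_' n [ F ]") : Group_scope.

(* The direct product of k copies of H; it is trivial when k = 0. *)
Definition direct_power (gT : finGroupType) (k : nat) (H : {group gT}) :
  {group {dffun forall _ : 'I_k, gT}} := [group of setXn (fun _ : 'I_k => H)].

(* Main.v *)
Require Import Defs.
From HB Require Import structures.
From mathcomp Require Import all_boot all_order all_fingroup all_algebra.
From mathcomp Require Import all_solvable all_field.
From mathcomp Require Import ring.

(** The irreducible representations of D_2p in characteristic 2 that are
    nontrivial on the rotations are two-dimensional: for a root of unity z of order p, the
    rotation a acts with eigenvalues z^r and z^-r, the reflection b swaps the
    eigenlines, and everything is defined over the field generated by the trace
    z^r + z^-r. Squaring the coefficients of such a representation turns r into
    2r, and r and -r give the same representation, so they should be counted by
    the cosets of the subgroup generated by 2 and -1 in the units of F_p.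
    This subgroup is cyclic: it is generated by 2, of order d, when d is even
    (then -1 is a power of 2), and by -2, of order 2d, when d is odd. With w the
    generator and q the size of F, both cases become the same statement
    [bicyclic_group_dihedral]: p divides q^2 - 1, and the k cosets of w satisfy
    q^k = 2^((p-1)/2).

    Since p divides q^2 - 1, the order q (q^2 - 1) of SL_2(F) is a multiple of
    p, and Cauchy's theorem provides a matrix of order p over F itself
    ([exists_rotmx]): no extension of F is needed, even when z is not in F. Let
    C be such a matrix and B an involution inverting it. For each residue r
    there is a representation a |-> C^r, b |-> B of the group
    ([dihedral_representations]), hence a ring morphism [alg_rep r] from the
    group algebra to the matrices. The isomorphism is [alg_rep] at one
    representative r of each coset of w.

    It is injective on the bicyclic group ([injm_SL_rep]). An element of the
    algebra is killed by every [alg_rep r] only if it is 0, by Fourier inversion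
    over the powers of C ([rot_sum_fourier]). The set of r at which it is killed
    is stable under r |-> w r, because its coefficients are in F_2
    ([rot_sum_double], [rot_sumN]). At r = 0 the image of the group algebra is
    commutative, which makes every bicyclic unit trivial there
    ([alg_rep0_bicyclic]).

    Its image is the whole product of special linear groups. Bicyclic units
    square to 1, so have determinant 1 in characteristic 2
    ([det_alg_rep_bicyclic]). For a reflection g, the unit of g and a^s is
    mapped to the transvections 1 + T(rs) (1 + g), T being the trace of powers
    of C ([alg_rep_bicyclic_reflection]). The vectors (T(r s))_r, for s from 1
    to (p-1)/2, are independent over F_2 by the same Fourier argument, and a
    count shows that they span F^k ([trace_vector_onto]). Thus the image
    contains all families of transvections 1 + v_r (1 + g), with an independent
    coefficient in each factor. Two reflections g give two root subgroups with
    distinct fixed lines, and every matrix of SL_2 is a word of fixed shape in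
    these ([SL2_bruhat]), so that the words can be chosen in all the factors
    simultaneously ([SL_rep_onto]). *)

Import GroupScope GRing.Theory.
Set Implicit Arguments.
Unset Strict Implicit.
Unset Printing Implicit Defensive.
Local Open Scope ring_scope.

(** * Two by two matrices *)

Section Matrix2.
Variable F : comNzRingType.
Implicit Types (a b c d : F) (M N : 'M[F]_2).

Definition mx2 a b c d : 'M[F]_2 :=
  \matrix_(i, j) (if i == 0 then if j == 0 then a else b
                            else if j == 0 then c else d).

Lemma mx2E M : M = mx2 (M 0 0) (M 0 1) (M 1 0) (M 1 1).
Proof.
by apply/matrixP=> i j; rewrite !mxE; case: i => [[|[|//]] i2];
   case: j => [[|[|//]] j2] /=; congr (M _ _); apply: val_inj.
Qed.

Lemma mx2D a b c d a' b' c' d' :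
  mx2 a b c d + mx2 a' b' c' d' = mx2 (a + a') (b + b') (c + c') (d + d').
Proof. by rewrite [LHS]mx2E !mxE. Qed.

Lemma mx2N a b c d : - mx2 a b c d = mx2 (- a) (- b) (- c) (- d).
Proof. by rewrite [LHS]mx2E !mxE. Qed.

Lemma mx2Z k a b c d : k *: mx2 a b c d = mx2 (k * a) (k * b) (k * c) (k * d).
Proof. by rewrite [LHS]mx2E !mxE. Qed.

Lemma mx2M a b c d a' b' c' d' :
  mx2 a b c d * mx2 a' b' c' d' =
  mx2 (a * a' + b * c') (a * b' + b * d') (c * a' + d * c') (c * b' + d * d').
Proof. by rewrite [LHS]mx2E !mxE !big_ord_recl !big_ord0 !mxE /= !addr0. Qed.

Lemma mx2_1 : 1 = mx2 1 0 0 1.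
Proof. by rewrite [LHS]mx2E !mxE. Qed.

Lemma mx2_0 : 0 = mx2 0 0 0 0.
Proof. by rewrite [LHS]mx2E !mxE. Qed.

Definition mx2s := (mx2_1, mx2_0, mx2M, mx2D, mx2N, mx2Z).

Lemma mx2_inj a b c d a' b' c' d' :
  mx2 a b c d = mx2 a' b' c' d' -> [/\ a = a', b = b', c = c' & d = d'].
Proof.
move/matrixP=> E; have := (E 0 0, E 0 1, E 1 0, E 1 1).
by rewrite !mxE /= => -[[[-> ->] ->] ->].
Qed.

Lemma det_mx2 a b c d : \det (mx2 a b c d) = a * d - b * c.
Proof.
rewrite (expand_det_row _ 0) !big_ord_recl big_ord0 /cofactor !det_mx11 !mxE /=.
rewrite /bump /= expr0 expr1; ring.
Qed.

Lemma mxtrace_mx2 a b c d : \tr (mx2 a b c d) = a + d.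
Proof. by rewrite /mxtrace !big_ord_recl big_ord0 !mxE /= addr0. Qed.

(** The Cayley-Hamilton theorem. *)
Lemma SL2_sqr M : \det M = 1 -> M ^+ 2 = \tr M *: M - 1.
Proof.
rewrite [M]mx2E det_mx2 mxtrace_mx2 expr2 => dM.
by rewrite !mx2s -dM; congr mx2; ring.
Qed.

End Matrix2.

Arguments mx2s {F}.

(** The two families 1 + c E and 1 + c N are the root subgroups of two distinct
    lines, which are opposite since N 1 0 != 0, and this is the Bruhat
    decomposition for them. What matters is that the length of the word does not
    depend on g: in a product of groups SL_2 the coefficients can then be
    chosen factor by factor. *)
Lemma SL2_bruhat (F : fieldType) (g N : 'M[F]_2) (E := mx2 0 1 0 0) :
  N * N = 0 -> N 1 0 != 0 -> \det g = 1 ->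
  exists c1 c2 c3 c4 c5, g = (1 + c1 *: E) * (1 + c2 *: N) * (1 + c3 *: E)
                             * (1 + c4 *: N) * (1 + c5 *: E).
Proof.
move=> N2 z0 dg.
have [n [m [z [NE nn]]]] :
    exists n m z, N = mx2 n m z (- n) /\ n * n = - (m * z).
  move: N2 z0; rewrite [N]mx2E !mxE /= {1}mx2s mx2_0.
  move: (N 0 0) (N 0 1) (N 1 0) (N 1 1) => n m z w.
  case/mx2_inj=> n2 _ zn _ z0; exists n, m, z; split.
    congr mx2; apply/(mulfI z0)/eqP; rewrite -subr_eq0 -zn; apply/eqP; ring.
  by apply/eqP; rewrite -subr_eq0 opprK n2.
have {}z0 : z != 0 by move: z0; rewrite NE !mxE.
(* The lower left entry is unchanged by the two outer factors: this gives the
   middle coefficient, and the diagonal entries give the outer ones. *)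
have big_cell h : \det h = 1 -> h 1 0 != 0 -> exists c1 c2 c3,
    h = (1 + c1 *: E) * (1 + c2 *: N) * (1 + c3 *: E).
  rewrite NE [h]mx2E det_mx2 !mxE /=.
  move: (h 0 0) (h 0 1) (h 1 0) (h 1 1) => a b k d dh k0.
  have -> : m = - (n * n / z) by rewrite nn; field.
  have -> : b = (a * d - 1) / k by rewrite -dh; field.
  exists ((a - 1 - k / z * n) / k), (k / z), ((d - 1 + k / z * n) / k).
  by rewrite /E !mx2s; congr mx2; field; apply/andP.
have [g10|] := eqVneq (g 1 0) 0; last first.
  move=> /(big_cell _ dg)[x [c [y ->]]]; exists x, c, y, 0, 0.
  by rewrite !scale0r !addr0 !mulr1.
(* For g upper triangular, multiplying by 1 - N, the inverse of 1 + N, moves g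
   into the big cell. *)
have detN : \det (1 - N) = 1.
  rewrite NE !mx2s det_mx2.
  have -> : (1 - n) * (1 - - n) = 1 - n * n by ring.
  by rewrite nn; ring.
have [] := big_cell (g * (1 - N)).
- by rewrite det_mulmx dg mul1r.
- move: g10 dg; rewrite NE [g]mx2E det_mx2 !mx2s !mxE /= => -> dg.
  rewrite !mul0r !add0r mulf_neq0 ?oppr_eq0 //.
  by apply: contra_eq_neq dg => ->; rewrite mulr0 mulr0 subr0 eq_sym oner_eq0.
move=> x [c [y E1]]; exists x, c, y, 1, 0.
rewrite -E1 scale1r scale0r addr0 mulr1 -mulrA.
by rewrite mulrDr mulr1 mulrBl mul1r N2 subr0 subrK mulr1.
Qed.

(** * Elements of odd prime order in SL_2 of a finite field *)

(** The coefficients depend only on t and n, not on M: two elements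
    with the same quadratic equation have powers given by the same formulas,
    which transports the relation M ^+ p = 1 from one to the other. *)
Lemma sqr_recurrence_pow (R : comNzRingType) (t : R) n :
  exists x y : R, forall (A : algType R) (M : A),
    M ^+ 2 = t *: M - 1 -> M ^+ n = x *: M + y%:A.
Proof.
elim: n => [|n [x [y IH]]].
  by exists 0, 1 => A M _; rewrite expr0 scale0r scale1r add0r.
exists (x * t + y), (- x) => A M M2; rewrite exprS (IH _ _ M2) mulrDr -!scalerAr.
rewrite mulr1 -expr2 M2 scalerBr scalerA scalerDl scaleNr.
by rewrite -!addrA; congr (_ + _); rewrite addrC.
Qed.

Lemma expr_odd_eq1 (R : pzRingType) (x : R) p :
  odd p -> x ^+ p = 1 -> x ^+ 2 = 1 -> x = 1.
Proof.
move=> p_odd xp x2; move: xp; rewrite -(odd_double_half p) p_odd -mul2n exprD.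
by rewrite exprM x2 expr1n mulr1.
Qed.

Section OrderPrime.
Variable F : finFieldType.

Fact GL2_det_unit (u : {'GL_2[F]}) : \det (GLval u) \is a GRing.unit.
Proof. by rewrite -unitmxE; apply: GL_unitmx. Qed.

Definition GL2_det u : {unit F} := FinRing.unit F (GL2_det_unit u).

Fact GL2_detM : {in [set: {'GL_2[F]}] &, {morph GL2_det : u v / (u * v)%g}}.
Proof. by move=> u v _ _; apply: val_inj; rewrite /= -det_mulmx. Qed.

Canonical GL2_det_morphism := Morphism GL2_detM.

Lemma ker_GL2_det : 'ker GL2_det = 'SL_2[F]%G.
Proof. by apply/setP=> u; rewrite !inE -val_eqE. Qed.

(** SL_2 is the kernel of the determinant on GL_2, whose image has order
    dividing q - 1. Divisibility is enough to find elements of order p and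
    spares the surjectivity of the determinant. *)
Lemma card_SL2_dvd : (#|F| * (#|F| ^ 2 - 1) %| #|'SL_2[F]%G|)%N.
Proof.
pose D := GL2_det @* 'GL_2[F].
have [m cm] : exists m, (#|F|.-1 = m * #|D|)%N.
  by apply/dvdnP; rewrite -card_finField_unit cardSg ?subsetT.
have cSL : (#|'SL_2[F]%G| * #|D| = #|'GL_2[F]|)%N.
  by rewrite -ker_GL2_det card_morphim setIid Lagrange ?subsetT.
apply/dvdnP; exists m; apply/eqP.
rewrite -(eqn_pmul2r (m := #|D|)); last exact: cardG_gt0.
rewrite cSL card_GL_2 (mulnAC m) -cm -[1%N in X in _ == X]/(1 ^ 2)%N subn_sqr.
by rewrite subn1 addn1; apply/eqP; move: #|F|.+1 #|F|.-1 => a b; ring.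
Qed.

Lemma SL2_order_p p : prime p -> (p %| #|F| ^ 2 - 1)%N ->
  exists A : 'M[F]_2, [/\ \det A = 1, A ^+ p = 1 & A != 1].
Proof.
move=> p_pr p_dvd.
have [] := @Cauchy _ p 'SL_2[F]%G p_pr.
  by apply: dvdn_trans card_SL2_dvd; apply: dvdn_mull.
move=> u; rewrite inE => /eqP du ou; exists (GLval u); split=> //.
  by rewrite -[LHS](FinRing.val_unitX p u) -ou expg_order.
apply/eqP=> u1; have: u = 1%g by apply: val_inj.
by move/eqP; rewrite -order_eq1 ou => /eqP p1; rewrite p1 in p_pr.
Qed.
End OrderPrime.

(** * A dihedral pair of matrices and Fourier inversion *)

Section Pair.
Variables (F : fieldType) (t : F).
Hypothesis (t_neq0 : t != 0) (charF2 : 2%N \in [pchar F]).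

(** A matrix of determinant 1 and trace t, and an involution inverting it,
    chosen so that 1 + reflmx is the elementary nilpotent mx2 0 1 0 0 in
    characteristic 2. *)
Definition rotmx : 'M[F]_2 := mx2 0 (- t^-1) t t.
Definition reflmx : 'M[F]_2 := mx2 1 1 0 (-1).
Local Notation C := rotmx.
Local Notation B := reflmx.

Lemma det_rotmx : \det C = 1.
Proof. by rewrite det_mx2 mul0r sub0r mulNr opprK mulVf. Qed.

Lemma rotmx_sqr : C ^+ 2 = t *: C - 1.
Proof. by rewrite SL2_sqr ?det_rotmx // mxtrace_mx2 add0r. Qed.

Lemma reflmxK : B * B = 1.
Proof. by rewrite !mx2s; congr mx2; ring. Qed.

Lemma refl_rotmx : B * C * B * C = 1.
Proof. by rewrite !mx2s; congr mx2; field. Qed.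

(** The algebra generated by C. *)
Definition rot_span (M : 'M[F]_2) := exists x y, M = x *: C + y%:A.

Lemma rot_spanP M : rot_span M ->
  exists x y, M = mx2 y (- x / t) (t * x) (y + t * x).
Proof.
case=> x [y ->]; exists x, y; rewrite !mx2s; congr mx2; ring.
Qed.

Lemma rot_span0 : rot_span 0.
Proof. by exists 0, 0; rewrite !scale0r addr0. Qed.

Lemma rot_spanD M N : rot_span M -> rot_span N -> rot_span (M + N).
Proof.
by move=> [x [y ->]] [z [w ->]]; exists (x + z), (y + w); rewrite !scalerDl addrACA.
Qed.

Lemma rot_spanZ c M : rot_span M -> rot_span (c *: M).
Proof.
by move=> [x [y ->]]; exists (c * x), (c * y); rewrite scalerDr !scalerA.
Qed.

Lemma rot_spanX n : rot_span (C ^+ n).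
Proof.
have [x [y E]] := sqr_recurrence_pow t n.
by exists x, y; apply: E; apply: rotmx_sqr.
Qed.

(** The images of the rotations and of the reflections are independent, so that
    the kernel of a representation can be studied on each coset of the
    rotations separately. *)
Lemma rot_span_free M N : rot_span M -> rot_span N -> M + N * B = 0 ->
  M = 0 /\ N = 0.
Proof.
move=> /rot_spanP[x [y ->]] /rot_spanP[z [w ->]]; rewrite !mx2s.
have F2 : 2%:R = 0 :> F := pcharf0 charF2.
case/mx2_inj; rewrite !(mulr1, mulr0, addr0, mulrN1) => e00 e01 e10 e11.
have x0 : x = 0.
  apply: (mulfI t_neq0); rewrite mulr0.
  have -> : t * x = (y + t * x + (t * z - (w + t * z))) - (y + w) + 2%:R * w by ring.
  by rewrite e00 e11 F2; ring.
have z0 : z = 0.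
  by apply: (mulfI t_neq0); rewrite mulr0 -e10 x0 mulr0 add0r.
have w0 : w = 0 by rewrite -e01 x0 z0; ring.
have y0 : y = 0 by rewrite -e00 w0 addr0.
by rewrite x0 y0 z0 w0; split; congr mx2; ring.
Qed.

Lemma pchar_mx2 : 2%N \in [pchar 'M[F]_2].
Proof.
apply/andP; split=> //; apply/eqP.
by rewrite -(rmorph_nat (@scalar_mx F 2)) (pcharf0 charF2) rmorph0.
Qed.

Section Powers.
Variable p : nat.
Hypotheses (p_pr : prime p) (p_odd : odd p) (Cp : C ^+ p = 1).
Implicit Types r s j : 'F_p.

(** As C has order dividing p, exponents are best taken in 'F_p, where they can be
    multiplied by 2 and by -1. *)
Definition rot r := C ^+ r.

Lemma rot0 : rot 0 = 1. Proof. exact: expr0. Qed.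

Lemma rot_nat n : rot n%:R = C ^+ n.
Proof. by rewrite /rot val_Fp_nat // expr_mod. Qed.

Lemma rotD r s : rot (r + s) = rot r * rot s.
Proof. by rewrite -exprD -rot_nat natrD !natr_Zp. Qed.

Lemma rotM r s : rot (r * s) = rot r ^+ s.
Proof. by rewrite -exprM -rot_nat natrM !natr_Zp. Qed.

Lemma rot_spanE r : rot_span (rot r). Proof. exact: rot_spanX. Qed.

Lemma rotN r : rot (- r) = B * rot r * B.
Proof.
have rotN1 : rot (-1) = B * C * B.
  have C1 : rot 1 = C by rewrite -[1]/(1%:R) rot_nat expr1.
  have: rot 1 * rot (-1) = 1 by rewrite -rotD subrr rot0.
  by rewrite C1 => E; rewrite -[LHS]mul1r -refl_rotmx -!mulrA E mulr1.
rewrite -mulN1r rotM rotN1 /rot; elim: {r}(r : nat) => [|n IH].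
  by rewrite !expr0 mulr1 reflmxK.
rewrite !exprS IH -!mulrA; congr (_ * (_ * _)).
by rewrite mulrA reflmxK mul1r.
Qed.

Lemma det_rot r : \det (rot r) = 1.
Proof.
by rewrite /rot; elim: {r}(r : nat) => [|n IH];
   rewrite ?expr0 ?det1 // exprS det_mulmx IH det_rotmx mulr1.
Qed.

(** In characteristic 2 the lower left entry of a matrix of the algebra
    generated by C is its trace: see [rot_spanP]. *)
Definition rot_trace r := rot r 1 0.

Lemma rot_traceE r : rot r + rot (- r) = (rot_trace r)%:A.
Proof.
have [x [y E]] := rot_spanP (rot_spanE r).
rewrite rotN /rot_trace E !mx2s !mxE /=.
congr mx2; try by ring.
  by rewrite -[RHS]addr0 -[in RHS](mulrn_pchar charF2 y); ring.
by rewrite -[RHS]addr0 -[in RHS](mulrn_pchar charF2 y); ring.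
Qed.

Lemma rot_neq1 r : r != 0 -> rot r != 1.
Proof.
move=> r0; apply/eqP=> rr; have: rot (r * r^-1) = 1 by rewrite rotM rr expr1n.
rewrite mulfV // -[1]/(1%:R) rot_nat expr1 /rotmx mx2_1 => /mx2_inj[/eqP].
by rewrite eq_sym oner_eq0.
Qed.

(** If the trace is 0 then rot r is equal to its inverse up to sign, hence is an
    involution in characteristic 2; but its order is odd. *)
Lemma rot_trace_neq0 r : r != 0 -> rot_trace r != 0.
Proof.
move=> r0; apply/eqP=> T0; case/eqP: (rot_neq1 r0).
apply: (@expr_odd_eq1 _ _ p) => //; first by rewrite /rot exprAC Cp expr1n.
have /eqP := rot_traceE r; rewrite T0 scale0r addr_eq0.
rewrite (oppr_pchar2 pchar_mx2) => /eqP E.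
by rewrite expr2 {2}E -rotD subrr rot0.
Qed.

(** For a matrix M of determinant 1, the determinant of M - 1 is 2 minus
    the trace. *)
Lemma rot_subr1_unit r : r != 0 -> rot r - 1 \is a GRing.unit.
Proof.
move=> /rot_trace_neq0; have := det_rot r; rewrite /rot_trace.
have [x [y ->]] := rot_spanP (rot_spanE r).
rewrite det_mx2 mx2s => dr; rewrite mx2s mx2s !mxE /= => T0.
rewrite unitmxE det_mx2 unitfE.
suff -> : (y + -1) * (y + t * x + -1) - (- x / t + - 0) * (t * x + - 0) = - (t * x).
  by rewrite oppr_eq0.
have F2 : 2%:R = 0 :> F := pcharf0 charF2.
have -> : - (t * x) = 1 + 1 - t * x - 2%:R * y by rewrite F2 -mulr2n F2; ring.
rewrite -[in X in X + 1]dr; ring.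
Qed.

(** Orthogonality of characters, without eigenvalues: multiplication by rot r
    permutes the terms, and rot r - 1 is invertible. *)
Lemma sum_rot r : r != 0 -> \sum_j rot (j * r) = 0.
Proof.
move=> r0; apply: (mulIr (rot_subr1_unit r0)); rewrite mul0r mulrBr mulr1.
rewrite mulr_suml [X in _ - X](reindex_inj (addIr 1)) /= -sumrB big1 // => j _.
by rewrite -rotD mulrDl mul1r subrr.
Qed.

Definition rot_sum (c : 'F_p -> F) r := \sum_j c j *: rot (r * j).

Lemma rot_sum_span c r : rot_span (rot_sum c r).
Proof.
rewrite /rot_sum; elim/big_ind: _ => [|*|j _]; first exact: rot_span0.
  exact: rot_spanD.
by apply: rot_spanZ; apply: rot_spanE.
Qed.

(** Fourier inversion: the sum of rot (- r l) * rot_sum c r over r is p times the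
    coefficient c l, and p is odd. *)
Lemma rot_sum_fourier c : (forall r, rot_sum c r = 0) -> forall j, c j = 0.
Proof.
move=> c0 l.
have: \sum_r rot (r * - l) * rot_sum c r = 0.
  by rewrite big1 // => r _; rewrite c0 mulr0.
rewrite /rot_sum; under eq_bigr => r _.
  rewrite mulr_sumr; under eq_bigr => j _ do rewrite -scalerAr -rotD -mulrDr.
  over.
rewrite exchange_big (bigD1 l) //= [X in _ + X]big1 ?addr0 => [|j jl]; last first.
  by rewrite -scaler_sumr sum_rot ?scaler0 // addrC subr_eq0.
under eq_bigr do rewrite addNr mulr0 rot0.
rewrite sumr_const card_Fp // -scaler_nat mx2_1 !mx2s => /mx2_inj[/eqP].
rewrite mulr1 mulf_eq0 => /orP[|/eqP-> //].
by rewrite -(dvdn_pcharf charF2) dvdn2 p_odd.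
Qed.

Lemma rot_sum0 c : rot_sum c 0 = (\sum_j c j)%:A.
Proof.
rewrite /rot_sum scaler_suml; apply: eq_bigr => j _.
by rewrite mul0r rot0.
Qed.

Lemma rot_sumN c r : rot_sum c (- r) = B * rot_sum c r * B.
Proof.
rewrite /rot_sum mulr_sumr mulr_suml; apply: eq_bigr => j _.
by rewrite mulNr rotN -scalerAr -scalerAl.
Qed.

(** The terms commute, so squaring is additive on them; coefficients in F_2 are
    fixed by squaring. *)
Lemma rot_sum_double c r : (forall j, c j ^+ 2 = c j) ->
  rot_sum c (2%:R * r) = rot_sum c r ^+ 2.
Proof.
move=> c2; rewrite /rot_sum.
have comm_sum (s : seq 'F_p) :
    (\sum_(j <- s) c j *: rot (r * j)) ^+ 2 =
    \sum_(j <- s) (c j *: rot (r * j)) ^+ 2.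
  elim: s => [|j s IH]; first by rewrite !big_nil expr0n.
  rewrite !big_cons -!(pFrobenius_autE pchar_mx2) pFrobenius_autD_comm.
    by rewrite !pFrobenius_autE IH.
  apply: commr_sum => i _; rewrite /GRing.comm -!scalerAl -!scalerAr -!rotD.
  by rewrite !scalerA mulrC addrC.
rewrite comm_sum; apply: eq_bigr => j _; rewrite exprZn c2; congr (_ *: _).
by rewrite expr2 -rotD -mulrA mulr_natl mulr2n.
Qed.

End Powers.
End Pair.

(** A matrix A of order p in SL_2(F) satisfies the equation A^2 = t A - 1 of
    rotmx t, for t its trace. Since p is odd, A is not a scalar, so A^p = 1 forces
    the coefficients of A^p in the basis A, 1 to be 0 and 1; these are also the
    coefficients of the power of rotmx t. *)
Lemma exists_rotmx (F : finFieldType) p : 2%N \in [pchar F] -> prime p -> odd p ->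
  (p %| #|F| ^ 2 - 1)%N -> exists2 t : F, t != 0 & rotmx t ^+ p = 1.
Proof.
move=> charF2 p_pr p_odd /(SL2_order_p p_pr)[A [dA Ap A1]].
have sqrA1 : A ^+ 2 != 1.
  by apply: contra_neq A1; apply: expr_odd_eq1 p_odd Ap.
have t0 : \tr A != 0.
  apply: contra_neq sqrA1 => t0.
  by rewrite SL2_sqr // t0 scale0r sub0r oppr_pchar2 //; apply: pchar_mx2.
exists (\tr A) => //.
have [x [y E]] := sqr_recurrence_pow (\tr A) p.
rewrite (E _ _ (rotmx_sqr t0)); have := E _ _ (SL2_sqr dA); rewrite Ap.
have [->|x0 E1] := eqVneq x 0; first by rewrite !scale0r !add0r => <-.
have {E1}[c Ac] : exists c, A = c%:M.
  exists (x^-1 * (1 - y)); apply: (scalerI x0).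
  rewrite -scalemx1 !scalerA mulVKf // scalerBl scale1r.
  by apply/eqP; rewrite eq_sym subr_eq -E1.
case/eqP: sqrA1; rewrite Ac expr2 -[_ * _]scalar_mxM.
by move: dA; rewrite Ac det_scalar expr2 => ->.
Qed.

(** * Extending group representations to the group algebra *)

Section Lift.
Variables (K : comNzRingType) (L : comNzRingType) (phi : {rmorphism K -> L}).
Variables (gT : finGroupType) (A : algType L) (rho : gT -> A).

(** The two conditions on rho are arguments so that the map can carry a
    canonical structure of ring morphism. *)
Definition galg_lift of rho 1%g = 1 & {morph rho : x y / (x * y)%g >-> x * y} :=
  fun f : group_algebra K gT => \sum_x phi (f x) *: rho x.

Hypotheses (rho1 : rho 1%g = 1)
  (rhoM : {morph rho : x y / (x * y)%g >-> x * y}).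
Local Notation lift := (galg_lift rho1 rhoM).

Lemma galg_lift_elt x : lift (galg_elt K x) = rho x.
Proof.
rewrite /lift (bigD1 x) //= ffunE eqxx rmorph1 scale1r big1 ?addr0 // => y nyx.
by rewrite ffunE (negPf nyx) rmorph0 scale0r.
Qed.

Fact galg_lift_additive : zmod_morphism lift.
Proof.
move=> f g; rewrite /lift -sumrB; apply: eq_bigr => x _.
by rewrite !ffunE rmorphB scalerBl.
Qed.

Fact galg_lift_multiplicative : monoid_morphism lift.
Proof.
split=> [|f g]; first by rewrite -galg_elt1 galg_lift_elt.
rewrite /lift mulr_suml; under [RHS]eq_bigr => y _.
  rewrite mulr_sumr (reindex_inj (mulgI y^-1%g)) /=.
  over.
rewrite exchange_big /=; apply: eq_bigr => x _.
rewrite ffunE rmorph_sum /= scaler_suml; apply: eq_bigr => y _.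
by rewrite rmorphM -scalerAr -scalerAl -rhoM mulKVg scalerA mulrC.
Qed.

HB.instance Definition _ :=
  GRing.isZmodMorphism.Build (group_algebra K gT) A lift galg_lift_additive.
HB.instance Definition _ :=
  GRing.isMonoidMorphism.Build (group_algebra K gT) A lift
    galg_lift_multiplicative.

End Lift.

(** The embedding of the prime field. *)
Definition Fp_incl p (R : nzRingType) (charRp : p \in [pchar R]) (x : 'F_p) : R :=
  GRing.in_alg (pPrimeCharType charRp) x.

HB.instance Definition _ p (R : nzRingType) (charRp : p \in [pchar R]) :=
  GRing.RMorphism.copy (Fp_incl charRp) (GRing.in_alg (pPrimeCharType charRp)).

Section UnitMap.
Variables (R S : finUnitRingType) (f : {rmorphism R -> S}).

Definition unit_map (u : {unit R}) : {unit S} :=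
  FinRing.unit S (rmorph_unit f (valP u)).

End UnitMap.

(** * The bicyclic group of a dihedral group through its representations *)

Section Representations.
Variables (F : finFieldType) (p : nat) (t : F).
Hypotheses (charF2 : 2%N \in [pchar F]) (p_pr : prime p) (p_odd : odd p).
Hypotheses (t_neq0 : t != 0) (Cp : rotmx t ^+ p = 1).
Local Notation B := (reflmx F).
Local Notation incl := (Fp_incl charF2).
Implicit Types r s m : 'F_p.

(* The dihedral group of order 2p, described by its normal form and its family
   of representations. *)
Variables (gT : finGroupType) (a b : gT) (rho : 'F_p -> gT -> 'M[F]_2).
Hypotheses (b_ord : (b ^+ 2 = 1)%g) (abV : (a ^ b = a^-1)%g).
Hypothesis normal_form :
  bijective (fun ie : 'F_p * bool => (a ^+ ie.1 * b ^+ ie.2)%g).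
Hypotheses (rho1 : forall r, rho r 1%g = 1)
           (rhoM : forall r, {morph rho r : x y / (x * y)%g >-> x * y}).
Hypotheses (rho_a : forall r, rho r a = rot t r) (rho_b : forall r, rho r b = B).

Definition alg_rep r : {rmorphism group_algebra 'F_2 gT -> 'M[F]_2} :=
  galg_lift incl (rho1 r) (rhoM r).

Lemma rhoX r x n : rho r (x ^+ n)%g = rho r x ^+ n.
Proof. by elim: n => [|n IH]; rewrite ?expg0 ?expr0 // expgS exprS rhoM IH. Qed.

Lemma rho_aX r (i : 'F_p) : rho r (a ^+ i)%g = rot t (r * i).
Proof. by rewrite rhoX rho_a rotM. Qed.

Definition coset_sum v (e : bool) r :=
  rot_sum t (fun i => incl (v (a ^+ i * b ^+ e)%g)) r.

Lemma alg_rep_coset_sum r (v : group_algebra 'F_2 gT) :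
  alg_rep r v = coset_sum v false r + coset_sum v true r * B.
Proof.
rewrite /= /galg_lift (reindex _ (onW_bij _ normal_form)) /=.
rewrite -(pair_bigA _ (fun (i : 'F_p) (e : bool) =>
  incl (v (a ^+ i * b ^+ e)%g) *: rho r (a ^+ i * b ^+ e)%g)) /=.
rewrite [X in _ = _ + X]mulr_suml -big_split; apply: eq_bigr => i _ /=.
rewrite big_bool /= addrC -scalerAl; congr (_ *: _ + _ *: _).
  by rewrite mulg1 rho_aX.
by rewrite rhoM rho_aX rho_b.
Qed.

Lemma alg_rep_eq0 r v : alg_rep r v = 0 -> forall e, coset_sum v e r = 0.
Proof.
rewrite alg_rep_coset_sum => /(rot_span_free t_neq0 charF2).
by case; [exact: rot_sum_span | exact: rot_sum_span | move=> E1 E2 []].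
Qed.

Section Representatives.
(* Representatives of the cosets of the group generated by w. *)
Variables (w : 'F_p) (k : nat) (rep : 'I_k -> 'F_p).
Hypotheses (w_pm2 : w = 2%:R \/ w = - 2%:R).
Hypotheses (rep_neq0 : forall l, rep l != 0).
Hypothesis rep_cover : forall s, s != 0 -> exists l n, s = w ^+ n * rep l.

(** The transform of coefficients in F_2 at 2r is the square of the transform at
    r, and at - r it is conjugate to the transform at r: its zeros are stable under
    multiplication by w, so it vanishes everywhere once it does at 0 and at
    the representatives. *)
Lemma rot_sum_eq0 (c : 'F_p -> 'F_2) : \sum_j c j = 0 ->
  (forall l, rot_sum t (fun j => incl (c j)) (rep l) = 0) -> forall j, c j = 0.
Proof.
move=> c0 cl j; apply: (fmorph_inj incl); rewrite rmorph0.
have c2 i : incl (c i) ^+ 2 = incl (c i).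
  rewrite -rmorphXn /=; congr (incl _).
  by case: (c i) => [[|[|//]]] ?; apply: val_inj.
suff: forall s, rot_sum t (fun j => incl (c j)) s = 0.
  by move/(rot_sum_fourier t_neq0 charF2 p_pr p_odd Cp)/(_ j).
have wE s : rot_sum t (fun j => incl (c j)) s = 0 ->
            rot_sum t (fun j => incl (c j)) (w * s) = 0.
  case: w_pm2 => -> E; last rewrite mulNr rot_sumN //.
    by rewrite rot_sum_double // E expr0n.
  by rewrite rot_sum_double // E expr0n /= mulr0 mul0r.
move=> s; have [->|/rep_cover[l [n ->]]] := eqVneq s 0.
  by rewrite rot_sum0 -rmorph_sum c0 rmorph0 scale0r.
by elim: n => [|n IH]; rewrite ?expr0 ?mul1r // exprS -mulrA wE.
Qed.

Lemma alg_rep_inj v :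
  alg_rep 0 v = 0 -> (forall l, alg_rep (rep l) v = 0) -> v = 0.
Proof.
move=> v0 vl.
have ve (e : bool) (i : 'F_p) : v (a ^+ i * b ^+ e)%g = 0 :> 'F_2.
  apply: (rot_sum_eq0 (c := fun i => v (a ^+ i * b ^+ e)%g)) => [|l]; last first.
    exact: alg_rep_eq0 (vl l) e.
  have := alg_rep_eq0 v0 e; rewrite /coset_sum rot_sum0 -rmorph_sum.
  move/eqP; rewrite scaler_eq0 oner_eq0 orbF => /eqP E.
  by apply: (fmorph_inj incl); rewrite rmorph0.
apply/ffunP=> x; rewrite ffunE; case: normal_form => h _ hK.
by rewrite -(hK x) ve.
Qed.

(** A bicyclic unit is 1 plus an element of square zero, so it squares to 1 in
    characteristic 2, and 1 is the only element of F of square 1. *)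
Lemma det_alg_rep_bicyclic r x y : \det (alg_rep r (bicyclic 'F_2 x y)) = 1.
Proof.
have sq1 : bicyclic 'F_2 x y ^+ 2 = 1.
  rewrite expr2 /bicyclic mulrDl mul1r mulrDr mulr1 bicyclic_sq0 addr0.
  rewrite -addrA; set n := _ * _ * _.
  have -> : n + n = 0; last by rewrite addr0.
  by apply/ffunP=> z; rewrite !ffunE (addrr_pchar2 (pchar_Fp _)).
have : (\det (alg_rep r (bicyclic 'F_2 x y))) ^+ 2 = 1.
  by rewrite expr2 -det_mulmx mulmxE -rmorphM -expr2 sq1 rmorph1 det1.
move/eqP; rewrite -subr_eq0 subr_sqr_1 oppr_pchar2 // mulf_eq0 orbb.
by rewrite addr_eq0 oppr_pchar2 // => /eqP.
Qed.

(** At r = 0 the rotations act trivially and the image is commutative; the factor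
    x - 1 can then be moved next to the sum of the powers of x, which it kills. *)
Lemma alg_rep0_bicyclic x y : alg_rep 0 (bicyclic 'F_2 x y) = 1.
Proof.
have rho0C z z' : rho 0 z * rho 0 z' = rho 0 z' * rho 0 z.
  have rho0E u : exists e : bool, rho 0 u = B ^+ e.
    case: normal_form => h _ hK; exists (h u).2; rewrite -{1}(hK u) rhoM rho_aX.
    by rewrite mul0r rot0 mul1r rhoX rho_b.
  have [e ->] := rho0E z; have [e' ->] := rho0E z'.
  by rewrite -!exprD addnC.
have rep0C z z' : GRing.comm (alg_rep 0 z) (alg_rep 0 z').
  apply: commr_sum => i _; apply/commr_sym/commr_sum => j _.
  by rewrite /GRing.comm -!scalerAl -!scalerAr rho0C !scalerA mulrC.
rewrite /bicyclic rmorphD rmorph1 rmorphM rmorphM (rep0C (_ - 1)) -mulrA.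
by rewrite (rep0C (_ - 1)) -rmorphM galg_hat_mulr rmorph0 mulr0 addr0.
Qed.

Definition reflection m : gT := (a ^+ m * b)%g.

Lemma rho_reflection r m : rho r (reflection m) = rot t (r * m) * B.
Proof. by rewrite /reflection rhoM rho_aX rho_b. Qed.

Lemma order_reflection m : #[reflection m]%g = 2%N.
Proof.
apply: nt_prime_order => //.
  rewrite expgS expg1 /reflection mulgA -(mulgA (a ^+ m)%g b).
  have -> : (b * a ^+ m = (a ^+ m)^-1 * b)%g.
    have bV : (b^-1 = b)%g.
      by apply/eqP; rewrite eq_invg_mul -[(b * b)%g]/(b ^+ 2)%g b_ord.
    rewrite -expgVn -abV -conjXg conjgE bV.
    by rewrite -!mulgA -[(b * b)%g]/(b ^+ 2)%g b_ord mulg1.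
  by rewrite mulgA mulgV mul1g -[(b * b)%g]/(b ^+ 2)%g b_ord.
apply/eqP=> E; have := rho_reflection 0 m; rewrite E rho1 mul0r rot0 mul1r.
by rewrite mx2_1 => /mx2_inj[_ /eqP]; rewrite eq_sym oner_eq0.
Qed.

(** This is the image of 1 + reflection m. *)
Definition refl_nil r m := 1 + rot t (r * m) * B.

Lemma refl_nil_sqr r m : refl_nil r m * refl_nil r m = 0.
Proof.
have S2 : rot t (r * m) * B * (rot t (r * m) * B) = 1.
  by rewrite mulrA -(mulrA _ B) -mulrA -rotN // -rotD // subrr rot0.
rewrite /refl_nil mulrDl mul1r mulrDr mulr1 S2.
by rewrite [_ + 1]addrC (addrr_pchar2 (pchar_mx2 charF2)).
Qed.

(** With S the image of the reflection g and R that of a^s, the relation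
    S R = R^-1 S gives (S - 1) R (1 + S) = (R^-1 - R) (1 + S), and R + R^-1 is a
    scalar, the trace of R. *)
Lemma alg_rep_bicyclic_reflection r m s :
  alg_rep r (bicyclic 'F_2 (reflection m) (a ^+ s)%g) =
  1 + rot_trace t (r * s) *: refl_nil r m.
Proof.
have repE z : alg_rep r (galg_elt _ z) = rho r z by apply: galg_lift_elt.
rewrite /bicyclic /galg_hat order_reflection !big_ord_recl big_ord0 addr0.
rewrite expg0 expg1 rmorphD rmorph1 !rmorphM rmorphB rmorph1 rmorphD !repE.
rewrite rho1 rho_reflection rho_aX; congr (1 + _); rewrite -/(refl_nil r m).
rewrite -[rot_trace _ _ *: _]mulr_algl -rot_traceE //.
set S := rot t (r * m) * B; set u := r * s.
have Sn : S * refl_nil r m = refl_nil r m.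
  apply/eqP; rewrite -[X in _ == X](oppr_pchar2 (pchar_mx2 charF2)) -addr_eq0.
  by rewrite addrC -{1}[refl_nil r m]mul1r -mulrDl [_ * _]refl_nil_sqr.
have SR : S * rot t u = rot t (- u) * S.
  rewrite rotN // /S -!mulrA.
  have -> : B * rot t u = rot t (- u) * B by rewrite rotN // -mulrA reflmxK mulr1.
  by rewrite mulrA -rotD // addrC rotD // rotN // -!mulrA.
rewrite mulrDl mulN1r SR mulrDl -mulrA Sn addrC mulrDl mulNr.
by rewrite (oppr_pchar2 (pchar_mx2 charF2)).
Qed.

Local Notation K := {dffun forall _ : 'I_k, {'GL_2[F]}}.
Local Notation G := (bicyclic_group 'F_2 gT).

Definition SL_rep (u : {unit group_algebra 'F_2 gT}) : K :=
  [ffun l => unit_map (alg_rep (rep l)) u : {'GL_2[F]}].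

Lemma SL_repM : {in G &, {morph SL_rep : u v / (u * v)%g}}.
Proof.
move=> u v _ _; apply/ffunP=> l; rewrite !ffunE.
by apply: val_inj; rewrite /= rmorphM.
Qed.

Canonical SL_rep_morphism := Morphism SL_repM.

Lemma alg_rep0_bicyclic_group u : u \in G -> alg_rep 0 (val u) = 1.
Proof.
pose H := [set u : {unit group_algebra 'F_2 gT} | alg_rep 0 (val u) == 1].
have gH : group_set H.
  apply/group_setP; split=> [|x y]; rewrite !inE ?rmorph1 //=.
  by move=> /eqP Hx /eqP Hy; rewrite rmorphM [X in X * _]Hx [X in _ * X]Hy mulr1.
suff /subsetP GH : G \subset Group gH by move/GH; rewrite inE => /eqP.
rewrite gen_subG; apply/subsetP=> _ /imset2P[x y _ _ ->].
by rewrite inE alg_rep0_bicyclic.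
Qed.

(** Vanishing at the representatives determines an element of the algebra only
    together with its image at r = 0, which is 1 on the whole bicyclic group. *)
Lemma injm_SL_rep : 'injm SL_rep.
Proof.
apply/subsetP=> u /morphpreP[Gu /set1P rep1]; apply/set1P.
apply: val_inj; apply/eqP; rewrite -subr_eq0; apply/eqP.
apply: alg_rep_inj => [|l]; rewrite rmorphB rmorph1.
  by rewrite (alg_rep0_bicyclic_group Gu) subrr.
have /(congr1 val) /= := congr1 (fun f : K => f l) rep1.
by rewrite !ffunE /= => ->; rewrite subrr.
Qed.

Lemma SL_rep_sub : SL_rep @* G \subset direct_power k 'SL_2[F]%G.
Proof.
rewrite sub_morphim_pre // gen_subG; apply/subsetP=> _ /imset2P[x y _ _ ->].
have Gxy : bicyclic_unit 'F_2 x y \in G by rewrite mem_gen // imset2_f.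
apply/morphpreP; split=> //; apply/setXnP=> l.
by rewrite inE ffunE; apply/eqP/det_alg_rep_bicyclic.
Qed.

Hypothesis card_k : (#|F| ^ k = 2 ^ p./2)%N.

(** Here j + 1 runs from 1 to (p-1)/2, one exponent for each pair a^s, a^-s of
    nontrivial rotations. *)
Definition trace_vector (c : {ffun 'I_(p./2) -> 'F_2}) : {ffun 'I_k -> F} :=
  [ffun l => \sum_j incl (c j) * rot_trace t (rep l * j.+1%:R)].

Lemma trace_vectorB c d : trace_vector (c - d) = trace_vector c - trace_vector d.
Proof.
apply/ffunP=> l; rewrite !ffunE -sumrB; apply: eq_bigr => j _.
by rewrite !ffunE rmorphB mulrBl.
Qed.

(** Spread c to the symmetric function d on 'F_p that is 0 at 0: its transform is
    the scalar matrix of the trace sums, so it vanishes at the representatives,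
    and at 0 because there every trace is 2 = 0. *)
Lemma trace_vector_eq0 c : trace_vector c = 0 -> c = 0.
Proof.
move=> c0; pose d s := \sum_(j < p./2) c j *
  ((s == j.+1%:R :> 'F_p)%:R + (s == - j.+1%:R :> 'F_p)%:R).
have rot_delta s x : \sum_i incl (i == x)%:R *: rot t (s * i) = rot t (s * x).
  rewrite (bigD1 x) //= eqxx rmorph1 big1 ?addr0 => [|i /negPf->].
    exact: scale1r.
  by rewrite rmorph0 scale0r.
have sum_d s : rot_sum t (fun i => incl (d i)) s =
    (\sum_(j < p./2) incl (c j) * rot_trace t (s * j.+1%:R))%:A.
  rewrite /rot_sum /d; under eq_bigr do rewrite rmorph_sum scaler_suml.
  rewrite exchange_big scaler_suml; apply: eq_bigr => j _ /=.
  under eq_bigr do rewrite rmorphM rmorphD -scalerA scalerDl.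
  rewrite -scaler_sumr big_split /= !rot_delta mulrN rot_traceE //.
  by rewrite scalerA.
have d0 : forall s, d s = 0.
  apply: rot_sum_eq0 => [|l]; last first.
    rewrite sum_d; have /ffunP/(_ l) := c0.
    by rewrite !ffunE => ->; rewrite scale0r.
  apply: (fmorph_inj incl); rewrite rmorph0 rmorph_sum /=.
  have := sum_d 0; rewrite rot_sum0 [X in _ = X%:A]big1 ?scale0r => [/eqP|j _].
    by rewrite scaler_eq0 oner_eq0 orbF => /eqP.
  by rewrite mul0r /rot_trace rot0 mx2_1 !mxE mulr0.
apply/ffunP=> j; rewrite ffunE -[RHS](d0 j.+1%:R) /d (bigD1 j) //= eqxx.
have nat_eq (m n : nat) : (m < p)%N -> (n < p)%N ->
    (m%:R == n%:R :> 'F_p) = (m == n).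
  by move=> mp np; rewrite -(inj_eq val_inj) /= !val_Fp_nat // !modn_small.
have lt_p (i : 'I_(p./2)) : (i.+1 < p)%N.
  rewrite -[X in (_ < X)%N]odd_double_half p_odd ltnS -addnn.
  exact: leq_trans (ltn_ord i) (leq_addr _ _).
have neqN (i i' : 'I_(p./2)) : (i.+1%:R == - i'.+1%:R :> 'F_p) = false.
  rewrite -addr_eq0 -natrD -(dvdn_pcharf (pchar_Fp p_pr)) gtnNdvd //.
  by rewrite -[X in (_ < X)%N]odd_double_half p_odd ltnS -addnn leq_add.
rewrite neqN addr0 mulr1 big1 ?addr0 // => i ij.
have /negPf ji : (j : nat) != i by rewrite eq_sym.
by rewrite neqN nat_eq // eqSS ji addr0 mulr0.
Qed.

Lemma trace_vector_onto v : exists c, v = trace_vector c.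
Proof.
have inj : injective trace_vector.
  move=> c d E; apply/eqP; rewrite -subr_eq0; apply/eqP/trace_vector_eq0.
  by rewrite trace_vectorB E subrr.
have [|h _ hK] := @inj_card_bij _ _ _ inj; last by exists (h v).
by rewrite !card_ffun !card_ord card_k.
Qed.

(** For fixed m the matrices 1 + x N, with N = refl_nil, multiply by adding the
    coefficients x, since N squares to 0. So the vectors v that occur form an additive
    group, and it contains the trace vectors, which span. *)
Lemma transvection_in_image m (v : {ffun 'I_k -> F}) :
  exists2 u, u \in G &
    forall l, alg_rep (rep l) (val u) = 1 + v l *: refl_nil (rep l) m.
Proof.
have [c ->] := trace_vector_onto v.
pose Q (v : {ffun 'I_k -> F}) := exists2 u, u \in G &
  forall l, alg_rep (rep l) (val u) = 1 + v l *: refl_nil (rep l) m.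
have Q0 : Q 0.
  by exists 1%g => // l; rewrite ffunE scale0r addr0 rmorph1.
have QD v1 v2 : Q v1 -> Q v2 -> Q (v1 + v2).
  move=> [u1 G1 E1] [u2 G2 E2]; exists (u1 * u2)%g; first exact: groupM.
  move=> l; rewrite /= rmorphM E1 E2 ffunE mulrDl mul1r mulrDr mulr1 -!scalerAl.
  rewrite -!scalerAr refl_nil_sqr !scaler0 addr0 scalerDl -addrA.
  by rewrite [v2 l *: _ + _]addrC.
have -> : trace_vector c =
    \sum_j [ffun l => incl (c j) * rot_trace t (rep l * j.+1%:R)].
  by apply/ffunP=> l; rewrite sum_ffunE ffunE; apply: eq_bigr => j _; rewrite ffunE.
rewrite -/(Q _); elim/big_ind: _ => // j _.
have : c j = 0 \/ c j = 1.
  by case: (c j) => [[|[|//]]] ?; [left | right]; apply: val_inj.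
case=> ->.
  have -> : [ffun l => incl 0 * rot_trace t (rep l * j.+1%:R)] = 0
      :> {ffun 'I_k -> F}.
    by apply/ffunP=> l; rewrite !ffunE rmorph0 mul0r.
  exact: Q0.
exists (bicyclic_unit 'F_2 (reflection m) (a ^+ (j.+1%:R : 'F_p))%g).
  by rewrite mem_gen // imset2_f.
by move=> l; rewrite ffunE rmorph1 mul1r; apply: alg_rep_bicyclic_reflection.
Qed.

Lemma SL_rep_onto : direct_power k 'SL_2[F]%G \subset SL_rep @* G.
Proof.
apply/subsetP=> g /setXnP SLg.
have refl_nil0 l : refl_nil (rep l) 0 = mx2 0 1 0 0.
  rewrite /refl_nil mulr0 rot0 mul1r mx2_1 mx2D (addrr_pchar2 charF2) !add0r.
  by rewrite subrr.
have refl_nil1 l : refl_nil (rep l) 1 1 0 != 0.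
  have := rot_trace_neq0 t_neq0 charF2 p_pr p_odd Cp (rep_neq0 l).
  rewrite /refl_nil mulr1 /rot_trace mx2_1; move: (rot t (rep l)) => M.
  by rewrite [M]mx2E mx2M mx2D !mxE /= mulr1 mulr0 addr0 add0r.
have word l : exists d : F * F * F * F * F, GLval (g l) =
    let: (c1, c2, c3, c4, c5) := d in
    (1 + c1 *: refl_nil (rep l) 0) * (1 + c2 *: refl_nil (rep l) 1)
      * (1 + c3 *: refl_nil (rep l) 0) * (1 + c4 *: refl_nil (rep l) 1)
      * (1 + c5 *: refl_nil (rep l) 0).
  have := SLg l; rewrite inE => /eqP dg.
  have [c1 [c2 [c3 [c4 [c5 E]]]]] :=
    SL2_bruhat (refl_nil_sqr (rep l) 1) (refl_nil1 l) dg.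
  by exists (c1, c2, c3, c4, c5); rewrite refl_nil0.
have [d dE] := fin_all_exists word.
have [u1 G1 E1] := transvection_in_image 0 [ffun l => (d l).1.1.1.1].
have [u2 G2 E2] := transvection_in_image 1 [ffun l => (d l).1.1.1.2].
have [u3 G3 E3] := transvection_in_image 0 [ffun l => (d l).1.1.2].
have [u4 G4 E4] := transvection_in_image 1 [ffun l => (d l).1.2].
have [u5 G5 E5] := transvection_in_image 0 [ffun l => (d l).2].
have Gu : (u1 * u2 * u3 * u4 * u5)%g \in G by rewrite !groupM.
apply/morphimP; exists (u1 * u2 * u3 * u4 * u5)%g => //.
apply/ffunP=> l; rewrite ffunE; apply: val_inj.
rewrite [LHS]dE /= !rmorphM E1 E2 E3 E4 E5 !ffunE.
by case: (d l) => [[[[]]]].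
Qed.

Lemma bicyclic_group_isog : G \isog direct_power k 'SL_2[F]%G.
Proof.
have <- : SL_rep @* G = direct_power k 'SL_2[F]%G.
  by apply/eqP; rewrite eqEsubset SL_rep_sub SL_rep_onto.
exact: sub_isog (subxx G) injm_SL_rep.
Qed.

End Representatives.
End Representations.

(** * The dihedral group of order 2p *)

(** The presentation of the dihedral group gives a morphism onto the group
    generated by x and y. The 2p elements x^i y^e are distinct, which is the order
    of the dihedral group: hence the morphism is injective and the normal form lifts. *)
Lemma dihedral_normal_form (gT : finGroupType) p (x y : gT) :
  prime p -> #[x]%g = p -> (y ^+ 2 = 1)%g -> (x ^ y = x^-1)%g -> y \notin <[x]>%g ->
  exists f : {morphism [set: 'D_(2 * p)] >-> gT}, exists a b : 'D_(2 * p),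
    [/\ f a = x, f b = y, injective f
      & bijective (fun ie : 'F_p * bool => (a ^+ ie.1 * b ^+ ie.2)%g)].
Proof.
move=> p_pr ox y2 xy y_x.
have : [group of <<[set x; y]>>] \homg 'D_(2 * p).
  rewrite mul2n Grp_dihedral ?prime_gt1 //; apply/existsP; exists (x, y).
  rewrite /= !xpair_eqE joing_idl joing_idr eqxx y2 xy -ox expg_order !eqxx.
  by [].
case/homgP=> f fD.
have [a _ fa] : exists2 a, a \in [set: 'D_(2 * p)] & x = f a.
  have /morphimP[a _ _] : x \in (f @* [set: 'D_(2 * p)])%g.
    by rewrite fD mem_gen // set21.
  by exists a; rewrite ?inE.
have [b _ fb] : exists2 b, b \in [set: 'D_(2 * p)] & y = f b.
  have /morphimP[b _ _] : y \in (f @* [set: 'D_(2 * p)])%g.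
    by rewrite fD mem_gen // set22.
  by exists b; rewrite ?inE.
pose g (ie : 'F_p * bool) := (a ^+ ie.1 * b ^+ ie.2)%g.
have inj_fg : injective (f \o g).
  move=> [i e] [j e'] /=; rewrite /g /= !morphM ?inE // !morphX ?inE // -fa -fb => E.
  have ee : e = e'.
    apply/eqP; apply: contraNT y_x => ne.
    have : (y ^+ e * (y ^+ e')^-1 \in <[x]>)%g.
      rewrite -[(y ^+ e)%g](mulKg (x ^+ i)%g) E !mulgA mulgK.
      by rewrite groupM ?groupV ?mem_cycle.
    case: e e' ne {E} => [] [] // _;
      by rewrite ?expg1 ?expg0 ?invg1 ?mulg1 ?mul1g ?groupV.
  rewrite ee in E *; move/mulIg/eqP: E.
  rewrite eq_expg_mod_order ox !modn_small -?[X in (_ < X)%N](Fp_cast p_pr) //.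
  by move/eqP/val_inj->.
have inj_g : injective g by move=> i j E; apply: inj_fg; rewrite /= E.
have bij_g : bijective g.
  apply: inj_card_bij => //.
  rewrite -cardsT mul2n card_dihedral ?prime_gt1 // card_prod card_Fp //.
  by rewrite card_bool muln2.
exists f, a, b; split=> // u v.
by case: bij_g => h _ hK E; apply: (can_inj hK); apply: inj_fg; rewrite /= !hK.
Qed.

(** All the representations are obtained at once, from one morphism to the
    product of the groups GL_2 indexed by r; its injectivity gives the relations
    between a and b. Order p of the rotation is seen at r = 1; at r = 0, where it is
    trivial, the reflection is seen not to be a power of it. *)
Lemma dihedral_representations (F : finFieldType) p (t : F) :
  2%N \in [pchar F] -> prime p -> odd p -> t != 0 -> rotmx t ^+ p = 1 ->
  exists (a b : 'D_(2 * p)) (rho : 'F_p -> 'D_(2 * p) -> 'M[F]_2),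
  [/\ (b ^+ 2 = 1)%g, (a ^ b = a^-1)%g,
      bijective (fun ie : 'F_p * bool => (a ^+ ie.1 * b ^+ ie.2)%g),
      forall r, rho r 1%g = 1 /\ {morph rho r : x y / (x * y)%g >-> x * y}
    & forall r, rho r a = rot t r /\ rho r b = reflmx F].
Proof.
move=> charF2 p_pr p_odd t0 Cp.
have uC (r : 'F_p) : rot t r \is a GRing.unit.
  by rewrite unitmxE det_rot // unitr1.
have uB : reflmx F \is a GRing.unit.
  by apply/unitrP; exists (reflmx F); rewrite reflmxK.
pose x : {dffun forall _ : 'F_p, {'GL_2[F]}} := [ffun r => FinRing.unit _ (uC r)].
pose y : {dffun forall _ : 'F_p, {'GL_2[F]}} := [ffun r => FinRing.unit _ uB].
have GLX (z : {dffun forall _ : 'F_p, {'GL_2[F]}}) n r :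
    GLval ((z ^+ n)%g r) = GLval (z r) ^+ n.
  elim: n => [|n IH]; first by rewrite ffunE.
  by rewrite expgS exprS ffunE GL_ME IH.
have GLeq (z z' : {dffun forall _ : 'F_p, {'GL_2[F]}}) :
    (forall r, GLval (z r) = GLval (z' r)) -> z = z'.
  by move=> zz; apply/ffunP=> r; apply: val_inj; apply: zz.
have xr r : GLval (x r) = rot t r by rewrite ffunE.
have yr r : GLval (y r) = reflmx F by rewrite ffunE.
have ox : #[x]%g = p.
  apply: nt_prime_order => //.
    by apply: GLeq => r; rewrite GLX xr /rot exprAC Cp expr1n ffunE.
  apply/eqP=> /(congr1 (fun z : {dffun forall _ : 'F_p, _} => GLval (z 1))).
  rewrite xr ffunE /= => /eqP; apply/negP/rot_neq1 => //; exact: oner_neq0.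
have y2 : (y ^+ 2 = 1)%g.
  by apply: GLeq => r; rewrite GLX yr expr2 reflmxK ffunE.
have xy : (x ^ y = x^-1)%g.
  apply/eqP; rewrite eq_sym eq_invg_mul; apply/eqP/GLeq => r.
  rewrite conjgE (_ : y^-1 = y)%g; last first.
    by apply/eqP; rewrite eq_invg_mul -[(y * y)%g]/(y ^+ 2)%g y2.
  rewrite !ffunE !GL_ME /= (mulrA (reflmx F)) -rotN // -rotD // addrN rot0 //.
have y_x : y \notin <[x]>%g.
  apply/negP=> /cycleP[i /(congr1 (fun z : {dffun forall _ : 'F_p, _} => GLval (z 0)))].
  rewrite GLX xr yr rot0 expr1n mx2_1 => /mx2_inj[_ /eqP].
  by rewrite oner_eq0.
have [f [a [b [fa fb inj_f nf]]]] := dihedral_normal_form p_pr ox y2 xy y_x.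
exists a, b, (fun r z => GLval (f z r)); split=> //.
- by apply: inj_f; rewrite morphX ?inE // morph1 fb.
- by apply: inj_f; rewrite morphJ ?morphV ?inE // fa fb.
- by move=> r; split=> [|u v]; rewrite ?morph1 ?morphM ?inE // ffunE.
- by move=> r; rewrite fa fb.
Qed.

Lemma cycle_coset_reps p (w : {unit 'F_p}) k :
  #|[set: {unit 'F_p}] : <[w]>|%g = k ->
  exists rep : 'I_k -> 'F_p, (forall l, rep l != 0) /\
    forall s, s != 0 -> exists l n, s = val w ^+ n * rep l.
Proof.
move=> <-.
exists (fun l : 'I_#|rcosets <[w]>%g [set: {unit 'F_p}]| =>
  val (repr (enum_val l) : {unit 'F_p})); split=> [l|s s0].
  by rewrite -unitfE; apply: valP.
have us : s \is a GRing.unit by rewrite unitfE.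
pose u : {unit 'F_p} := FinRing.unit _ us.
have Hu : (<[w]> :* u)%g \in rcosets <[w]> [set: {unit 'F_p}].
  by apply/rcosetsP; exists u; rewrite ?inE.
exists (enum_rank_in Hu (<[w]> :* u)%g); rewrite enum_rankK_in //.
have /rcosetP[_ /cycleP[n ->] ->] := mem_repr_rcoset <[w]>%G u.
have [m mE] : exists m, (w ^- n = w ^+ m)%g.
  by apply/cycleP; rewrite groupV mem_cycle.
by exists m; rewrite -FinRing.val_unitX -mE -FinRing.val_unitM mulKg.
Qed.

(** The case distinction on d is reduced to the choice of w. *)
Lemma bicyclic_group_dihedral (F : finFieldType) p (w : {unit 'F_p}) k :
  prime p -> odd p -> 2%N \in [pchar F] -> (p %| #|F| ^ 2 - 1)%N ->
  val w = 2%:R \/ val w = - 2%:R ->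
  (k * #[w]%g = p.-1)%N -> (#|F| ^ k = 2 ^ p./2)%N ->
  bicyclic_group 'F_2 'D_(2 * p) \isog direct_power k 'SL_2[F]%G.
Proof.
move=> p_pr p_odd charF2 p_dvd w2 kw card_k.
have [t t0 Cp] := exists_rotmx charF2 p_pr p_odd p_dvd.
have [a [b [rho [b2 ab nf rhoM rho_ab]]]] :=
  dihedral_representations charF2 p_pr p_odd t0 Cp.
have [|rep [rep0 repC]] := @cycle_coset_reps p w k.
  by rewrite -divgS ?subsetT // card_finField_unit card_Fp // -kw mulnK ?order_gt0.
have rho1 r := (rhoM r).1; have {}rhoM r := (rhoM r).2.
have rho_a r := (rho_ab r).1; have rho_b r := (rho_ab r).2.
exact: (bicyclic_group_isog charF2 p_pr p_odd t0 Cp b2 ab nf rho1 rhoM rho_a rho_b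
  w2 rep0 repC card_k).
Qed.

Theorem theorem4 (p d : nat) (p_prime : prime p) (p_odd : odd p)
    (ord_d : (d.-primitive_root (2%:R : 'F_p))%R) :
  (~~ odd d -> forall F : finFieldType, #|F| = (2 ^ (d %/ 2))%N ->
     bicyclic_group 'F_2 'D_(2 * p) \isog
       direct_power (totient p %/ d) 'SL_2[F]%G)
  /\
  (odd d -> forall F : finFieldType, #|F| = (2 ^ d)%N ->
     bicyclic_group 'F_2 'D_(2 * p) \isog
       direct_power (totient p %/ (2 * d)) 'SL_2[F]%G).
Proof.
have two_neq0 : (2%:R : 'F_p) != 0.
  rewrite -(dvdn_pcharf (pchar_Fp p_prime)) dvdn_prime2 //.
  by apply: contraL p_odd => /eqP->.
have u2 : (2%:R : 'F_p) \is a GRing.unit by rewrite unitfE.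
pose w : {unit 'F_p} := FinRing.unit _ u2.
have ow : #[w]%g = d.
  apply/eqP; rewrite eqn_dvd order_dvdn (prim_order_dvd ord_d).
  rewrite -!val_eqE !FinRing.val_unitX /= (prim_expr_order ord_d) eqxx /=.
  by rewrite -(FinRing.val_unitX _ w) expg_order.
have char2 (F : finFieldType) n : #|F| = (2 ^ n)%N -> 2%N \in [pchar F].
  by move/card_finPcharP; apply.
have p_dvd n : (d %| n)%N -> (p %| 2 ^ n - 1)%N.
  rewrite (dvdn_pcharf (pchar_Fp p_prime)) natrB ?expn_gt0 // natrX.
  by rewrite (prim_order_dvd ord_d) => /eqP->; rewrite subrr.
have totientE n (v : {unit 'F_p}) : #[v]%g = n -> (totient p %/ n * n = p.-1)%N.
  have cU : #|[set: {unit 'F_p}]| = p.-1 by rewrite card_finField_unit card_Fp.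
  by move=> <-; rewrite totient_prime // -cU divnK // order_dvdG ?inE.
have half_p : p.-1 = p./2.*2 by rewrite -[in LHS](odd_double_half p) p_odd.
split=> [d_even | d_odd] F cF.
  have dE : (d %/ 2 * 2 = d)%N by rewrite divnK // dvdn2.
  apply: (bicyclic_group_dihedral (w := w)) => //; first exact: char2 cF.
  - by rewrite cF -expnM dE p_dvd.
  - by left.
  - by rewrite ow (totientE _ w).
  rewrite cF -expnM; congr (2 ^ _)%N; apply: double_inj.
  by rewrite -half_p -(totientE d w) // -muln2 mulnAC dE mulnC.
pose n1 : {unit 'F_p} := FinRing.unit _ (unitrN1 'F_p).
have n1_ord : #[n1]%g = 2%N.
  apply: nt_prime_order => //; first by apply: val_inj; rewrite /= mulN1r opprK.
  rewrite -val_eqE /= -subr_eq0 -opprD oppr_eq0.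
  by move: two_neq0; rewrite mulr2n.
have ov : #[(n1 * w)%g]%g = (2 * d)%N.
  rewrite orderM ?n1_ord ?ow ?coprime2n //.
  by apply: val_inj; rewrite /= mulrC.
apply: (bicyclic_group_dihedral (w := (n1 * w)%g)) => //; first exact: char2 cF.
- by rewrite cF -expnM p_dvd // dvdn_mulr.
- by right; rewrite /= mulN1r.
- by rewrite ov (totientE _ (n1 * w)%g).
rewrite cF -expnM; congr (2 ^ _)%N; apply: double_inj.
by rewrite -half_p -(totientE _ _ ov) -mul2n mulnA mulnC.
Qed.
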